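(* Let $n\ge1$ and $1\le p\le n$. A permutation $\pi\in S_n$ lies in $\bigcap_{r=1}^{n+1}\mathcal{T}_n^{(r,p)}$ if and only if $p+i-n\le \pi^{-1}_i\le p+i-1$ for all $1\le i\le n$. Further, the number of such permutations is $C_{p,n-p}$.
   Context: Sites are the integers $0,\dots,n+1$. A configuration in $\mathcal{S}(n,p)$ places $n+1$ distinct chips labeled $1,\dots,n+1$ with sites $0,n+1$ empty, one chip at each site of $\{1,\dots,n\}\setminus\{p\}$ and two chips at site $p$. Toppling: while some site holds at least two chips, choose such a site $i$ and two chips $\alpha<\beta$ there and move $\alpha$ to $i-1$, $\beta$ to $i+1$. It is known this terminates with at most one chip per site within sites $0,\dots,n+1$ and that the final configuration is independent of the choices; reading labels left to right gives a permutation of $[n+1]$. For $\pi\in S_n$, $r\in[n+1]$, $\pi^{(r,p)}$ places at site $i$ ($1\le i\le n$) chip $\pi_i$ if $\pi_i<r$ and $\pi_i+1$ otherwise, plus chip $r$ at site $p$. $\mathcal{T}_n^{(r,p)}$ is the set of $\pi\in S_n$ for which toppling $\pi^{(r,p)}$ gives the identity. $\pi^{-1}_i$ denotes the position of $i$ in $\pi$. Poly-Bernoulli numbers of type C are here $C_{n,k}=\sum_{m=0}^{\min(n,k)}(m!)^2\left\{{n+1\atop m+1}\right\}\left\{{k\atop m}\right\}$ (Stirling numbers of the second kind), so that $C_{n,0}=1$ for $n\ge0$ and $C_{0,k}=0$ for $k\ge1$. *)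

(* Defs.v *)
From mathcomp Require Import all_boot all_order all_algebra all_fingroup.
Set Implicit Arguments. Unset Strict Implicit. Unset Printing Implicit Defensive.
Import GRing.Theory Num.Theory.

(* A configuration records, for each chip label c (only labels 1..N matter),
   the site (an integer) where chip c sits. *)
Definition config := nat -> int.

Definition topple_step (N : nat) (c c' : config) : Prop :=
  exists a b : nat, [/\ 1 <= a, a < b, b <= N, c a = c b &
    c' = (fun k => if k == a then (c a - 1)%R
                   else if k == b then (c b + 1)%R else c k)].

Inductive reaches (N : nat) : config -> config -> Prop :=
| reaches_refl c : reaches N c c
| reaches_step c c' c'' : topple_step N c c' -> reaches N c' c'' -> reaches N c c''.

Definition stable (N : nat) (c : config) : Prop :=
  forall a b, 1 <= a -> a < b -> b <= N -> c a <> c b.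

Definition reads_identity (N : nat) (c : config) : Prop :=
  forall a b, 1 <= a -> a < b -> b <= N -> (c a < c b)%R.

Definition pval n (pi : 'S_n) (i : 'I_n) : nat := (pi i).+1.
Definition pinvpos n (pi : 'S_n) (i : 'I_n) : nat := ((perm_inv pi) i).+1.

(* The configuration pi^{(r,p)}: site i (1<=i<=n) holds chip pi_i if pi_i < r
   and pi_i + 1 otherwise; additionally chip r sits at site p.  Chip c <> r
   therefore sits at the site i with pi_i = c (if c < r) or pi_i = c - 1
   (if c > r). *)
Definition init_config n (pi : 'S_n) (r p : nat) : config :=
  fun c =>
    if c == r then Posz p
    else let v := if c < r then c else c.-1 in
         if @insub nat (fun k => k < n) 'I_n v.-1 is Some i
         then (if 1 <= v then Posz (pinvpos pi i) else Posz 0)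
         else Posz 0.

(* pi in T_n^{(r,p)}: toppling pi^{(r,p)} (with n+1 chips) terminates in the
   identity; by the known confluence/termination it suffices that some
   toppling sequence reaches a stable configuration reading the identity. *)
Definition inT n (r p : nat) (pi : 'S_n) : Prop :=
  exists c, reaches n.+1 (init_config pi r p) c /\ stable n.+1 c /\ reads_identity n.+1 c.

Fixpoint stirling2 (n k : nat) : nat :=
  match n, k with
  | 0, 0 => 1
  | 0, _.+1 => 0
  | _.+1, 0 => 0
  | n'.+1, k'.+1 => k * stirling2 n' k + stirling2 n' k'
  end.

Definition polyBernC (n k : nat) : nat :=
  \sum_(m < (minn n k).+1) (m`! ^ 2) * stirling2 n.+1 m.+1 * stirling2 k m.

(* Main.v *)
Require Import Defs.
From mathcomp Require Import all_boot all_order all_algebra all_fingroup.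
From mathcomp Require Import zify.
Set Implicit Arguments. Unset Strict Implicit. Unset Printing Implicit Defensive.

(** Put h = n + 1 - p and think of the chips as travelling on p "rows" and h
    "columns" that cross in a p x h grid. Row a starts at site p - a (row 0 with
    the chip r), column b at site p + b; chips on rows move right, chips on
    columns move left, and toppling a site is one crossing (a, b): the larger
    chip leaves on the row, the smaller one on the column. The crossings done so
    far always form a Young diagram, whose corners are the sites that can be
    toppled. The condition "row a carries a chip <= n + 1 - a and column b a chip
    >= b + 1" holds before a crossing iff it holds after it, and once the grid is
    filled it says that the configuration is sorted. Hence it characterises
    sorting in terms of the initial configuration, whatever the order of topplings.

    For the count, a permutation in the band splits the board into two full
    rectangles and two staircases (p x p with diagonal, k x k without, k = n - p).
    If m of the first p rows avoid their staircase, then m of the last k rows avoid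
    theirs, and the four parts can be filled in S(p+1, m+1), S(k, m), m! and m!
    ways. *)

(** * Crossing wires *)


Definition topple (c : config) (a b : nat) : config :=
  fun k => if k == a then (c a - 1)%R else if k == b then (c b + 1)%R else c k.

Definition upd (f : nat -> nat) (i v : nat) : nat -> nat :=
  fun j => if j == i then v else f j.

Lemma upd_eq f i v : upd f i v i = v. Proof. by rewrite /upd eqxx. Qed.

(* [lam] is the Young diagram of the crossings done so far, by row lengths, and
   [mu] its conjugate. *)
Record wired (p h : nat) (R C lam mu : nat -> nat) (c : config) : Prop := Wired {
  row_chip : forall a, a < p -> 1 <= R a <= p + h;
  col_chip : forall b, b < h -> 1 <= C b <= p + h;
  row_inj : forall a a', a < p -> a' < p -> R a = R a' -> a = a';
  col_inj : forall b b', b < h -> b' < h -> C b = C b' -> b = b';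
  row_neq_col : forall a b, a < p -> b < h -> R a <> C b;
  wire_surj : forall x, 1 <= x <= p + h ->
    (exists2 a, a < p & R a = x) \/ (exists2 b, b < h & C b = x);
  conj_shape : forall a b, a < p -> b < h -> (b < lam a) = (a < mu b);
  lam_le : forall a, a < p -> lam a <= h;
  mu_le : forall b, b < h -> mu b <= p;
  row_site : forall a, a < p -> (c (R a) + a%:Z = (p + lam a)%:Z)%R;
  col_site : forall b, b < h -> (c (C b) + (mu b)%:Z = (p + b)%:Z)%R;
  crossed : forall a b, a < p -> b < h -> b < lam a -> C b < R a }.

Definition admissible p h (R C : nat -> nat) :=
  (forall a, a < p -> R a + a <= p + h) /\ (forall b, b < h -> b < C b).

Lemma pigeonhole (f : nat -> nat) m lo hi :
  (forall i, i < m -> lo < f i <= hi) ->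
  (forall i j, i < m -> j < m -> f i = f j -> i = j) -> m <= hi - lo.
Proof.
move=> fran finj; rewrite -[m](size_iota 0) -(size_map f) -[hi - lo](size_iota lo.+1).
apply: uniq_leq_size.
  rewrite map_inj_in_uniq ?iota_uniq // => i j; rewrite !mem_iota => *.
  by apply: finj.
by move=> x /mapP[i]; rewrite mem_iota => im ->; rewrite mem_iota; have := fran i im; lia.
Qed.

Section Wires.
Variables (p h : nat).

(** Otherwise column [lam a] would contain row [a'] but not the earlier row [a], although by
    [conj_shape] it consists of its first [mu (lam a)] rows. *)
Lemma row_order R C lam mu c a a' : wired p h R C lam mu c ->
  a < a' -> a' < p -> lam a' <= lam a.
Proof.
move=> w aa a'p; rewrite leqNgt; apply/negP => lt.
have lh := lam_le w a'p.
have := conj_shape w (ltn_trans aa a'p) (leq_trans lt lh).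
have := conj_shape w a'p (leq_trans lt lh).
lia.
Qed.

Lemma col_order R C lam mu c b b' : wired p h R C lam mu c ->
  b < b' -> b' < h -> mu b' <= mu b.
Proof.
move=> w bb b'h; rewrite leqNgt; apply/negP => lt.
have lh := mu_le w b'h.
have := conj_shape w (leq_trans lt lh) (ltn_trans bb b'h).
have := conj_shape w (leq_trans lt lh) b'h.
lia.
Qed.

(** Sharing a site means [lam a + mu b = a + b]. A crossed pair has [lam a > b] and [mu b > a], an
    uncrossed one [lam a <= b] and [mu b <= a]; only equality in both remains. *)
Lemma meet_corner R C lam mu c a b : wired p h R C lam mu c ->
  a < p -> b < h -> c (R a) = c (C b) -> lam a = b /\ mu b = a.
Proof.
move=> w ap bh e; have := row_site w ap; have := col_site w bh.
have := conj_shape w ap bh; rewrite e; lia.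
Qed.

(** Row sites [p + lam a - a] strictly decrease in [a] and column sites [p + b - mu b] strictly
    increase in [b], so chips that share a site lie on one row and one column. *)
Lemma topple_step_corner R C lam mu c c' : wired p h R C lam mu c ->
  topple_step (p + h) c c' ->
  exists a b, [/\ a < p, b < h, lam a = b, mu b = a &
    c' = topple c (minn (R a) (C b)) (maxn (R a) (C b))].
Proof.
move=> w [x [y [x1 xy yN e ->]]].
have xN : 1 <= x <= p + h by lia.
have yN' : 1 <= y <= p + h by lia.
case: (wire_surj w xN) => -[i ip ix]; case: (wire_surj w yN') => -[j jp jy].
- have := row_site w ip; have := row_site w jp; rewrite ix jy e.
  have [ij|ij|ij] := ltngtP i j; last by subst; lia.
  + by have := row_order w ij jp; lia.
  + by have := row_order w ij ip; lia.
- have [|li mj] := meet_corner w ip jp; first by rewrite ix jy.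
  exists i, j; split=> //.
  by rewrite ix jy (minn_idPl (ltnW xy)) (maxn_idPr (ltnW xy)).
- have [|li mj] := meet_corner w jp ip; first by rewrite ix jy.
  exists j, i; split=> //.
  by rewrite ix jy (minn_idPr (ltnW xy)) (maxn_idPl (ltnW xy)).
- have := col_site w ip; have := col_site w jp; rewrite ix jy e.
  have [ij|ij|ij] := ltngtP i j; last by subst; lia.
  + by have := col_order w ij jp; lia.
  + by have := col_order w ij ip; lia.
Qed.

Lemma corner_topple_step R C lam mu c a b : wired p h R C lam mu c ->
  a < p -> b < h -> lam a = b -> mu b = a ->
  topple_step (p + h) c (topple c (minn (R a) (C b)) (maxn (R a) (C b))).
Proof.
move=> w ap bh la mb.
have e : c (R a) = c (C b).
  by have := row_site w ap; have := col_site w bh; lia.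
have rc := row_neq_col w ap bh.
have := row_chip w ap; have := col_chip w bh => rb cb.
exists (minn (R a) (C b)), (maxn (R a) (C b)); split=> //; try lia.
by rewrite /minn /maxn; case: ifP; rewrite e.
Qed.

(** The larger chip moves right and must leave on the row, so the two wires exchange their chips
    exactly when [R a < C b]. *)
Lemma wired_topple R C lam mu c a b : wired p h R C lam mu c ->
  a < p -> b < h -> lam a = b -> mu b = a ->
  wired p h (upd R a (maxn (R a) (C b))) (upd C b (minn (R a) (C b)))
    (upd lam a b.+1) (upd mu b a.+1)
    (topple c (minn (R a) (C b)) (maxn (R a) (C b))).
Proof.
move=> w ap bh la mb.
have e : c (R a) = c (C b).
  by have := row_site w ap; have := col_site w bh; lia.
have rc := row_neq_col w ap bh.
have rb := row_chip w ap; have cb := col_chip w bh.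
have emax : c (maxn (R a) (C b)) = c (R a) by rewrite /maxn; case: ifP.
have emin : c (minn (R a) (C b)) = c (R a) by rewrite /minn; case: ifP.
split; rewrite /upd.
- by move=> i ip; case: eqP => [_|_]; [lia|apply: (row_chip w)].
- by move=> i ip; case: eqP => [_|_]; [lia|apply: (col_chip w)].
- move=> i j ip jp; have := @row_inj _ _ _ _ _ _ _ w i j ip jp.
  have := row_neq_col w ip bh; have := row_neq_col w jp bh.
  have := @row_inj _ _ _ _ _ _ _ w i a ip ap; have := @row_inj _ _ _ _ _ _ _ w a j ap jp.
  by case: eqP => [->|?]; case: eqP => [->|?] //; lia.
- move=> i j ip jp; have := @col_inj _ _ _ _ _ _ _ w i j ip jp.
  have := row_neq_col w ap ip; have := row_neq_col w ap jp.
  have := @col_inj _ _ _ _ _ _ _ w i b ip bh; have := @col_inj _ _ _ _ _ _ _ w b j bh jp.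
  by case: eqP => [->|?]; case: eqP => [->|?] //; lia.
- move=> i j ip jp; have := row_neq_col w ip jp.
  have := row_neq_col w ip bh; have := row_neq_col w ap jp.
  have := @row_inj _ _ _ _ _ _ _ w i a ip ap.
  have := @col_inj _ _ _ _ _ _ _ w j b jp bh.
  by case: eqP => [->|?]; case: eqP => [->|?] //; lia.
- move=> x xN; have [lt|ge] := ltnP (R a) (C b).
  + case: (wire_surj w xN) => -[i ip ix].
    * have [ia|/eqP ia] := eqVneq i a.
        by right; exists b; rewrite // eqxx -ix ia; lia.
      by left; exists i => //; case: eqP ia.
    * have [ia|/eqP ia] := eqVneq i b.
        by left; exists a; rewrite // eqxx -ix ia; lia.
      by right; exists i => //; case: eqP ia.
  + case: (wire_surj w xN) => -[i ip ix].
    * by left; exists i => //; case: eqP => // ?; subst; lia.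
    * by right; exists i => //; case: eqP => // ?; subst; lia.
- move=> i j ip jp; have := conj_shape w ip jp.
  case: eqP => [->|?]; case: eqP => [->|?] //; lia.
- by move=> i ip; case: eqP => _ //; exact: (lam_le w).
- by move=> i ip; case: eqP => _ //; exact: (mu_le w).
- move=> i ip; rewrite /topple; have := row_site w ip; have := row_site w ap.
  have := row_neq_col w ip bh; have := @row_inj _ _ _ _ _ _ _ w i a ip ap.
  have [->|ia] := eqVneq i a.
    case: eqP => [|_]; first lia.
    by rewrite eqxx emax la; lia.
  case: eqP => [|_]; first lia.
  by case: eqP => [|_]; first lia.
- move=> i ip; rewrite /topple; have := col_site w ip; have := col_site w bh.
  have := row_neq_col w ap ip; have := @col_inj _ _ _ _ _ _ _ w i b ip bh.
  have [->|ia] := eqVneq i b.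
    by rewrite eqxx emin mb; lia.
  case: eqP => [|_]; first lia.
  by case: eqP => [|_]; first lia.
(* The label on row [a] can only grow and that on column [b] only shrink, so the inequalities of
   earlier crossings survive. *)
- move=> i j ip jp; have := @crossed _ _ _ _ _ _ _ w i j ip jp.
  have := @crossed _ _ _ _ _ _ _ w a j ap jp.
  have := @crossed _ _ _ _ _ _ _ w i b ip bh.
  have := conj_shape w ip bh; have := conj_shape w ap jp.
  by case: eqP => [->|?]; case: eqP => [->|?] //; lia.
Qed.

(* Forwards, the [a] rows that column [b] has already crossed carry chips
   larger than [C b], so [C b] leaves room for row [a]; dually for [R a]. *)
Lemma admissible_topple R C lam mu c a b : wired p h R C lam mu c ->
  a < p -> b < h -> lam a = b -> mu b = a ->
  admissible p h (upd R a (maxn (R a) (C b))) (upd C b (minn (R a) (C b))) <->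
  admissible p h R C.
Proof.
move=> w ap bh la mb.
have Cb : a <= p + h - C b.
  apply: (@pigeonhole R) => [i ia|i j ia ja]; last by apply: (row_inj w); lia.
  have ip : i < p by lia.
  have := conj_shape w ip bh; have := @crossed _ _ _ _ _ _ _ w i b ip bh.
  by have := row_chip w ip; lia.
have Ra : b <= (R a).-1 - 0.
  apply: (@pigeonhole C) => [i ia|i j ia ja]; last by apply: (col_inj w); lia.
  have ip : i < h by lia.
  have := conj_shape w ap ip; have := @crossed _ _ _ _ _ _ _ w a i ap ip.
  by have := col_chip w ip; lia.
have rb := row_chip w ap; have cb := col_chip w bh.
rewrite /admissible /upd; split=> -[gR gC]; split=> i ih.
- by have := gR i ih; case: eqP => [->|]; lia.
- by have := gC i ih; case: eqP => [->|]; lia.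
- by have := gR i ih; case: eqP => [->|]; lia.
- by have := gC i ih; case: eqP => [->|]; lia.
Qed.

Lemma reaches_wired R C lam mu c c' : wired p h R C lam mu c ->
  reaches (p + h) c c' ->
  exists R' C' lam' mu', wired p h R' C' lam' mu' c' /\
    (admissible p h R' C' <-> admissible p h R C).
Proof.
move=> w cc; elim: cc R C lam mu w => {c c'} [c|c c1 c2 st _ IH] R C lam mu w.
  by exists R, C, lam, mu.
have [a [b [ap bh la mb e]]] := topple_step_corner w st; subst c1.
have := IH _ _ _ _ (wired_topple w ap bh la mb).
move=> [R' [C' [lam' [mu' [w' g]]]]].
exists R', C', lam', mu'; split=> //.
by rewrite g (admissible_topple w ap bh la mb).
Qed.

(** * Filling the grid and reading off the final configuration *)

(** Take the first row that is not full: all rows before it are full, so the column of its first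
    missing cell contains exactly these rows. *)
Lemma exists_corner R C lam mu c a : wired p h R C lam mu c ->
  a < p -> lam a < h -> exists a' b, [/\ a' < p, b < h, lam a' = b & mu b = a'].
Proof.
move=> w ap la.
have ex : exists a, (a < p) && (lam a < h) by exists a; rewrite ap.
case: (ex_minnP ex) => m /andP[mp mh] min.
exists m, (lam m); split=> //.
have := conj_shape w mp mh; rewrite ltnn => /esym lt.
apply/eqP; rewrite eqn_leq leqNgt lt /=; case: m mp mh lt min => // m mp mh lt min.
have mp' : m < p by lia.
rewrite -(conj_shape w mp' mh); have := min m; have := lam_le w mp'; lia.
Qed.

Lemma wired_complete R C lam mu c : wired p h R C lam mu c ->
  exists R' C' lam' mu' c', [/\ reaches (p + h) c c', wired p h R' C' lam' mu' c',
    (admissible p h R' C' <-> admissible p h R C) &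
    forall a, a < p -> lam' a = h].
Proof.
(* Induction on a bound for the number of cells not yet crossed. *)
move: {2}_.+1 (ltnSn (p * h - \sum_(a < p) lam a)) => m.
elim: m R C lam mu c => // m IH R C lam mu c lt w.
have [/existsP[a la]|/existsPn full] := boolP [exists a : 'I_p, lam a < h].
  have [{la}a [b [ap bh la mb]]] := exists_corner w (ltn_ord a) la.
  have w' := wired_topple w ap bh la mb.
  have [|R' [C' [lam' [mu' [c' [rc w'' g f]]]]]] := IH _ _ _ _ _ _ w'.
    (* Subtraction truncates, so this bound is what makes the number of remaining cells drop
       strictly. *)
    have : \sum_(i < p) upd lam a b.+1 i <= p * h.
      rewrite -[p in p * h]card_ord -sum_nat_const; apply: leq_sum => i _.
      exact: (lam_le w').
    have -> : \sum_(i < p) upd lam a b.+1 i = (\sum_(i < p) lam i).+1.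
      rewrite (bigD1 (Ordinal ap)) //= [in RHS](bigD1 (Ordinal ap)) //= upd_eq la addSn.
      congr (_ + _).+1; apply: eq_bigr => i ia.
      by rewrite /upd; case: eqP => // ia'; case/eqP: ia; apply: val_inj.
    lia.
  exists R', C', lam', mu', c'; split=> //; last first.
    by rewrite g (admissible_topple w ap bh la mb).
  by apply: reaches_step rc; apply: (corner_topple_step w).
exists R, C, lam, mu, c; split=> //; first exact: reaches_refl.
move=> a ap; have := full (Ordinal ap); have := lam_le w ap; rewrite /=; lia.
Qed.

Lemma full_mu R C lam mu c : 0 < p -> wired p h R C lam mu c ->
  (forall a, a < p -> lam a = h) -> forall b, b < h -> mu b = p.
Proof.
move=> p0 w full b bh; have p1 : p.-1 < p by lia.
have := conj_shape w p1 bh; rewrite full //; have := mu_le w bh; lia.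
Qed.

Lemma stable_full R C lam mu c : wired p h R C lam mu c ->
  stable (p + h) c -> forall a, a < p -> lam a = h.
Proof.
move=> w st a ap; have := lam_le w ap; rewrite leq_eqVlt => /orP[/eqP //|la].
have [a' [b [a'p bh la' mb]]] := exists_corner w ap la.
have [x [y [x1 xy yN e _]]] := corner_topple_step w a'p bh la' mb.
by case: (st x y).
Qed.

(** On the full grid the rows end at sites [h + 1] to [p + h], the columns at [0] to [h - 1], and
    site [h] is empty. Sortedness then puts chip [x] at site [x - 1] if [x <= h] and at [x]
    otherwise, which bounds the chip of each wire. *)
Lemma sorted_admissible R C lam mu c : 0 < p -> wired p h R C lam mu c ->
  stable (p + h) c -> reads_identity (p + h) c -> admissible p h R C.
Proof.
move=> p0 w st rd.
have full := stable_full w st; have fullm := full_mu p0 w full.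
have rs a : a < p -> (c (R a) + a%:Z = (p + h)%:Z)%R.
  by move=> ap; rewrite (row_site w ap) full.
have cs b : b < h -> (c (C b) = b%:Z)%R.
  by move=> bh; have := col_site w bh; rewrite fullm //; lia.
have nh x : 1 <= x <= p + h -> (c x <> h%:Z)%R.
  by move=> /(wire_surj w)[[a ap <-]|[b bh <-]]; [have := rs a ap|have := cs b bh]; lia.
have ge0 x : 1 <= x <= p + h -> (0 <= c x)%R.
  by move=> /(wire_surj w)[[a ap <-]|[b bh <-]]; [have := rs a ap|have := cs b bh]; lia.
have leN x : 1 <= x <= p + h -> (c x <= (p + h)%:Z)%R.
  by move=> /(wire_surj w)[[a ap <-]|[b bh <-]]; [have := rs a ap|have := cs b bh]; lia.
(* Strict growth from either end gives [x - 1 <= c x <= x]. *)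
have lo x : 1 <= x <= p + h -> (x%:Z <= c x + 1)%R.
  elim: x => // x IH xN; case: x IH xN => [|x] IH xN; first by have := ge0 1 xN; lia.
  by have := rd x.+1 x.+2; have := IH; lia.
have hi d : d < p + h -> (c (p + h - d)%N <= (p + h - d)%:Z)%R.
  elim: d => [|d IH] dN; first by rewrite subn0; apply: leN; lia.
  by have := rd (p + h - d.+1) (p + h - d); have := IH; lia.
(* The empty site [h] decides between the two values: it sharpens the bound at chip [h + 1], and for
   [small] at chip [h], and monotonicity carries this outwards. *)
have big d : h + d.+1 <= p + h -> ((h + d.+1)%:Z <= c (h + d.+1)%N)%R.
  elim: d => [|d IH] dN; first by have := lo (h + 1); have := nh (h + 1); lia.
  by have := rd (h + d.+1) (h + d.+2); have := IH; lia.
have small d : d < h -> (c (h - d)%N < (h - d)%:Z)%R.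
  elim: d => [|d IH] dN.
    by have := hi p; have := nh h; rewrite subn0 addKn; lia.
  by have := rd (h - d.+1) (h - d); have := IH; lia.
split=> [a ap|b bh].
- have := row_chip w ap; have := rs a ap.
  have [?|lt] := leqP (R a) h; first lia.
  by have := big (R a - h).-1; rewrite (_ : h + _.+1 = R a); lia.
- have := col_chip w bh; have := cs b bh.
  have [le|?] := leqP (C b) h; last lia.
  by have := small (h - C b); rewrite (_ : h - (h - _) = C b); lia.
Qed.

(** Label [p + h - a] has only row [a] left: earlier rows hold larger labels by induction, later
    rows are bounded by admissibility, and on a column it would be smaller than [R a], which cannot
    exceed it. The columns are dual. *)
Lemma admissible_sorted R C lam mu c : 0 < p -> wired p h R C lam mu c ->
  (forall a, a < p -> lam a = h) -> admissible p h R C ->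
  stable (p + h) c /\ reads_identity (p + h) c.
Proof.
move=> p0 w full [gR gC]; have fullm := full_mu p0 w full.
have RC a b : a < p -> b < h -> C b < R a.
  by move=> ap bh; apply: (crossed w); rewrite ?full.
have Rval a : a < p -> R a = p + h - a.
  elim/ltn_ind: a => a IH ap; have aN : 1 <= p + h - a <= p + h by lia.
  case: (wire_surj w aN) => -[i ip ix].
    have [ia|ia|ia] := ltngtP i a; last by rewrite -ix ia.
    + by have := IH i ia ip; lia.
    + by have := gR i ip; lia.
  by have := gR a ap; have := RC a i ap ip; lia.
have Cval b : b < h -> C b = b.+1.
  elim/ltn_ind: b => b IH bh; have bN : 1 <= b.+1 <= p + h by lia.
  case: (wire_surj w bN) => -[i ip ix].
    by have := gC b bh; have := RC i b ip bh; lia.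
  have [ia|ia|ia] := ltngtP i b; last by rewrite -ix ia.
  - by have := IH i ia ip; lia.
  - by have := gC i ip; lia.
have rd : reads_identity (p + h) c.
  move=> x y x1 xy yN.
  have xN : 1 <= x <= p + h by lia.
  have yN' : 1 <= y <= p + h by lia.
  case: (wire_surj w xN) => -[i ip ix]; case: (wire_surj w yN') => -[j jp jy].
  - have := row_site w ip; have := row_site w jp; have := full i ip; have := full j jp.
    by have := Rval i ip; have := Rval j jp; rewrite ix jy; lia.
  - by have := RC i j ip jp; lia.
  - have := col_site w ip; have := row_site w jp; have := fullm i ip; have := full j jp.
    by rewrite ix jy; lia.
  - have := col_site w ip; have := col_site w jp; have := fullm i ip; have := fullm j jp.
    by have := Cval i ip; have := Cval j jp; rewrite ix jy; lia.
by split=> // x y x1 xy yN; have := rd x y x1 xy yN; lia.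
Qed.

Lemma wired_sorting R C lam mu c : 0 < p -> wired p h R C lam mu c ->
  (exists c', reaches (p + h) c c' /\ stable (p + h) c' /\ reads_identity (p + h) c') <->
  admissible p h R C.
Proof.
move=> p0 w; split=> [[c' [cc' [st rd]]]|ad].
  have [R' [C' [lam' [mu' [w' <-]]]]] := reaches_wired w cc'.
  exact: sorted_admissible w' st rd.
have [R' [C' [lam' [mu' [c' [cc' w' g full]]]]]] := wired_complete w.
by exists c'; split=> //; apply: (admissible_sorted p0 w' full); apply/g.
Qed.

End Wires.

(** * The initial configuration *)

Section Initial.
Variables (n p : nat) (pi : 'S_n).
Hypothesis pn : 1 <= p <= n.
Let h := n.+1 - p.

(* Sites are numbered from 1; the values outside [1..n] are junk. *)
Definition chip_at (s : nat) : nat :=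
  if @insub nat (fun k => k < n) 'I_n s.-1 is Some i then (pi i).+1 else 0.

Lemma chip_atE (i : 'I_n) : chip_at i.+1 = (pi i).+1.
Proof. by rewrite /chip_at insubT //= => lt; rewrite (_ : Sub _ _ = i) //; apply: val_inj. Qed.

Lemma chip_at_ran s : 1 <= s <= n -> 1 <= chip_at s <= n.
Proof.
case: s => // s sn; have lt : s < n by lia.
by rewrite -[s]/(val (Ordinal lt)) chip_atE; have := ltn_ord (pi (Ordinal lt)).
Qed.

Lemma chip_at_inj s t : 1 <= s <= n -> 1 <= t <= n -> chip_at s = chip_at t -> s = t.
Proof.
case: s => // s sn; case: t => // t tn; have ls : s < n by lia.
have lt : t < n by lia.
rewrite -[s]/(val (Ordinal ls)) -[t]/(val (Ordinal lt)) !chip_atE => -[/val_inj/perm_inj] //.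
by move=> ->.
Qed.

Lemma chip_at_surj v : 1 <= v <= n -> exists2 s, 1 <= s <= n & chip_at s = v.
Proof.
case: v => // v vn; have lt : v < n by lia.
exists ((pi^-1)%g (Ordinal lt)).+1; last by rewrite chip_atE permKV.
by have := ltn_ord ((pi^-1)%g (Ordinal lt)).
Qed.

(** [bump r], which skips the value [r], is the relabelling that makes room for chip [r]. *)
Lemma init_config_chip r s : 1 <= s <= n ->
  init_config pi r p (bump r (chip_at s)) = s.
Proof.
case: s => // s sn; have lt : s < n by lia.
rewrite -[s]/(val (Ordinal lt)) chip_atE /init_config /bump.
set i := Ordinal lt.
rewrite (_ : (_ == r) = false); last by lia.
have -> : (if (r <= (pi i).+1) + (pi i).+1 < r then (r <= (pi i).+1) + (pi i).+1
  else ((r <= (pi i).+1) + (pi i).+1).-1) = (pi i).+1 by case: ltnP => ?; lia.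
rewrite /= insubT //= => lt'; rewrite /pinvpos (_ : Sub _ _ = pi i); last exact: val_inj.
by rewrite permK.
Qed.

Definition init_row r a := if a is 0 then r else bump r (chip_at (p - a)).
Definition init_col r b := bump r (chip_at (p + b)).

Lemma init_wired r : 1 <= r <= n.+1 ->
  wired p h (init_row r) (init_col r) (fun=> 0) (fun=> 0) (init_config pi r p).
Proof.
move=> rn; have bump_inj v w : bump r v = bump r w -> v = w.
  by rewrite /bump; lia.
have bump_r v : bump r v <> r by rewrite /bump; lia.
have bump_ran s : 1 <= s <= n -> 1 <= bump r (chip_at s) <= n.+1.
  by move/chip_at_ran; rewrite /bump; lia.
have eh : p + h = n.+1 by rewrite /h; lia.
split=> //; rewrite ?eh.
- by case=> [|a] ap //; apply: bump_ran; lia.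
- by move=> b bh; apply: bump_ran; lia.
- case=> [|a] [|a'] ap ap' //.
  + by move=> /esym/bump_r.
  + by move=> /bump_r.
  + by move=> /bump_inj/chip_at_inj; lia.
- by move=> b b' bh bh' /bump_inj/chip_at_inj; lia.
- case=> [|a] b ap bh; first by move=> /esym/bump_r.
  by move=> /bump_inj/chip_at_inj; lia.
- move=> x xn; have [->|xr] := eqVneq x r; first by left; exists 0; rewrite //; lia.
  have [|s sn es] := @chip_at_surj (unbump r x); first by rewrite /unbump; lia.
  have ex : bump r (chip_at s) = x by rewrite es unbumpK // inE; exact/eqP.
  have [sp|ps] := ltnP s p.
    left; exists (p - s); first lia.
    by rewrite /init_row; case e : (p - s) => [|d]; [lia|rewrite -e subKn // ltnW].
  right; exists (s - p); first lia.
  by rewrite /init_col subnKC.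
- case=> [|a] ap; first by rewrite /init_row /init_config eqxx; lia.
  by rewrite init_config_chip; lia.
- by move=> b bh; rewrite init_config_chip; lia.
Qed.

Lemma inT_admissible r : 1 <= r <= n.+1 ->
  inT r p pi <-> admissible p h (init_row r) (init_col r).
Proof.
move=> rn; have p0 : 0 < p by lia.
have eh : n.+1 = p + h by rewrite /h; lia.
by rewrite /inT {1 2 3}eh; exact: (wired_sorting p0 (init_wired rn)).
Qed.

(** Two values of [r] decide: [r = 1] raises every other label and is strictest for the rows,
    [r = n + 1] raises none and is strictest for the columns. Left of [p] only the row bound
    matters, from [p] on only the column bound; the other one is automatic. *)
Lemma all_inT : (forall r, 1 <= r <= n.+1 -> inT r p pi) <->
  (forall i : 'I_n, p + i.+1 <= pinvpos pi i + n /\ pinvpos pi i <= p + i.+1 - 1).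
Proof.
transitivity (forall s, 1 <= s <= n -> p + chip_at s <= s + n /\ s < p + chip_at s).
  split=> [all s sn|all r rn].
    have cr := chip_at_ran sn; split.
      have [sp|ps] := ltnP s p; last lia.
      have r1 : 1 <= 1 <= n.+1 by [].
      have /(inT_admissible r1)[adR _] := all 1 r1.
      have := adR (p - s); rewrite /init_row; case e : (p - s) => [|d]; first lia.
      rewrite -e subKn ?(ltnW sp) // /bump /h; lia.
    have [sp|ps] := ltnP s p; first lia.
    have rn : 1 <= n.+1 <= n.+1 by lia.
    have /(inT_admissible rn)[_ adC] := all n.+1 rn.
    have := adC (s - p); rewrite /init_col subnKC // /bump /h; lia.
  apply/(inT_admissible rn); split=> [[|a] ap|b bh]; first by rewrite /= /h; lia.
    by have [] := all (p - a.+1); rewrite /= /bump /h; lia.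
  have [] := all (p + b); rewrite /init_col /bump; move: bh; rewrite /h; lia.
split=> [all i|all [|s] // sn].
  have := all (pinvpos pi i); rewrite /pinvpos chip_atE permKV.
  by have := ltn_ord ((perm_inv pi) i); move=> lt [] //; lia.
have lt : s < n by lia.
have := all (pi (Ordinal lt)); rewrite -[s]/(val (Ordinal lt)) chip_atE.
by rewrite /pinvpos permK /=; lia.
Qed.

End Initial.

(** * Placements of non-attacking rooks *)


Lemma stirling2_gt m j : m < j -> stirling2 m j = 0.
Proof.
elim: m j => [|m IH] [|j] //= mj.
by rewrite !IH ?muln0; lia.
Qed.

Section Rook.
Variable J : finType.
Implicit Types (rows : seq {set J}) (X Y D : {set J}).

(** The rows form a list, so that postponing the choice in a row amounts to permuting the list. *)
Fixpoint placements rows Y : nat :=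
  if rows is X :: rows' then \sum_(c in Y | c \in X) placements rows' (Y :\ c) else 1.

Lemma placements_swap X X' rows Y :
  placements (X :: X' :: rows) Y = placements (X' :: X :: rows) Y.
Proof.
rewrite /=; set F := fun c c' => placements rows (Y :\ c :\ c').
transitivity (\sum_(c in Y | c \in X) \sum_(c' in Y | (c' \in X') && (c' != c)) F c c').
  by apply: eq_bigr => c _; apply: eq_bigl => c'; rewrite !inE andbC andbA andbC andbCA andbA.
rewrite (exchange_big_dep (fun c => (c \in Y) && (c \in X'))) /=; last first.
  by move=> c c' _ /and3P[-> ->].
apply: eq_bigr => c' /andP[cY cX']; apply: eq_big => [c|c _].
  by rewrite !inE cY cX' /= [c' == c]eq_sym; case: (c == c'); rewrite ?andbF ?andbT.
by rewrite /F !setDDl setUC.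
Qed.

Lemma placements_perm rows rows' Y :
  perm_eq rows rows' -> placements rows Y = placements rows' Y.
Proof.
have mid X s t Z : placements (s ++ X :: t) Z = placements (X :: s ++ t) Z.
  elim: s Z => // A s IH Z; rewrite -placements_swap /=.
  by apply: eq_bigr => c _; rewrite IH.
elim: rows rows' Y => [|X rows IH] rows' Y.
  by move/perm_size/esym/size0nil ->.
move=> e; have := perm_mem e X; rewrite mem_head => /esym/splitPr def.
case: def e => s t e; rewrite mid /=; apply: eq_bigr => c _; apply: IH.
by rewrite -(perm_cons X) (perm_trans e) // perm_catC /= perm_cons perm_catC.
Qed.

(** A row either uses its staircase part [X] now or survives as a row with only the rectangle part
    [D]. *)
Lemma placements_split X D rows Y : [disjoint X & D] ->
  placements (X :|: D :: rows) Y =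
  \sum_(c in Y | c \in X) placements rows (Y :\ c) + placements (D :: rows) Y.
Proof.
move=> dis /=; rewrite (bigID (fun c => c \in X)) /=; congr (_ + _); apply: eq_bigl => c.
  by rewrite !inE; case: (c \in X); rewrite ?andbT ?andbF.
rewrite !inE; have [cX|] := boolP (c \in X); last by rewrite andbT.
by rewrite andbF (disjointFr dis cX) andbF.
Qed.

(** Rows of one type never take a cell usable by the other type, so two falling factorials
    multiply. *)
Lemma placements_two_types (A B Y : {set J}) a b : [disjoint A & B] ->
  placements (nseq a A ++ nseq b B) Y = #|Y :&: A| ^_ a * #|Y :&: B| ^_ b.
Proof.
have one X m (Z : {set J}) rows v : (forall c, c \in Z -> c \in X -> placements rows (Z :\ c) = v) ->
    #|Z :&: X| = m -> placements (X :: rows) Z = m * v.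
  move=> e <-; rewrite /= -sum_nat_const; apply: eq_big => [c|c /andP[cZ cX]]; first by rewrite inE.
  exact: e.
move=> dis; elim: a Y => [|a IH] Y.
  rewrite ffactn0 mul1n cat0s; elim: b Y => // b IH Y.
  rewrite (one _ _ _ _ (#|Y :&: B|.-1 ^_ b) _ erefl) ?ffactnS // => c cY cB.
  by rewrite IH setIDAC (cardsD1 c (Y :&: B)) inE cY cB.
rewrite (one _ _ _ _ (#|Y :&: A|.-1 ^_ a * #|Y :&: B| ^_ b) _ erefl) ?ffactnS ?mulnA // => c cY cA.
rewrite -/(cat _ _) IH !setIDAC (cardsD1 c (Y :&: A)) inE cY cA; congr (_ * _ ^_ _).
by rewrite (setDidPl _) // disjoint_sym disjoints1 inE (disjointFr dis cA) andbF.
Qed.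

(* Fills the rows of a staircase one at a time when [d] of the previous rows have
   been deferred: the next row uses one of the [d + delta] free cells of the
   staircase or is deferred too. [val m] weights the placements with [m] deferred
   rows in total. *)
Fixpoint stair_weight (delta : nat) (val : nat -> nat) q d : nat :=
  if q is q'.+1 then (d + delta) * stair_weight delta val q' d + stair_weight delta val q' d.+1
  else val d.

(** After [q0] rows, the total weight of having deferred [d] of them is
    [stirling2 (q0 + delta) (d + delta)]; treating one more row is the Stirling recurrence. *)
Lemma stair_weightE delta val q :
  delta <= 1 ->
  stair_weight delta val q 0 =
  \sum_(d < q.+1) stirling2 (q + delta) (d + delta) * val d.
Proof.
move=> d1; suff H q0 q1 : stair_weight delta val (q0 + q1) 0 =
    \sum_(d < q0.+1) stirling2 (q0 + delta) (d + delta) * stair_weight delta val q1 d.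
  by rewrite -[q in LHS]addn0 H.
elim: q0 q1 => [|q0 IH] q1.
  by rewrite big_ord1 add0n; case: delta d1 => [|[|]] // _; rewrite mul1n.
rewrite addSnnS IH [RHS]big_ord_recl /=.
set m := q0 + delta; set W := stair_weight _ _ _.
have S0 j : stirling2 m j.+1 * j.+1 + stirling2 m j = stirling2 m.+1 j.+1.
  by rewrite /= mulnC.
(* At the lowest index the recurrence loses its second term: for [delta = 0] both sides vanish, for
   [delta = 1] one has [m > 0] and [stirling2 m 0 = 0]. *)
have -> : stirling2 m.+1 delta * W 0 = stirling2 m delta * (delta * W 0).
  rewrite mulnA; congr (_ * _); rewrite /m; case: (delta) d1 => [|[|]] // _; first by rewrite muln0.
  by rewrite addn1 /= addn0 muln1 mul1n.
have -> : \sum_(i < q0.+1) stirling2 m.+1 (i.+1 + delta) * W i.+1 =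
  \sum_(i < q0.+1) stirling2 m (i.+1 + delta) * ((i.+1 + delta) * W i.+1) +
  \sum_(i < q0.+1) stirling2 m (i + delta) * W i.+1.
  rewrite -big_split; apply: eq_bigr => i _.
  by rewrite addSn -S0 mulnDl mulnA.
rewrite addnA -(big_ord_recl q0.+1 (fun i => stirling2 m (i + delta) * ((i + delta) * W i))).
rewrite [X in _ = X + _]big_ord_recr /= stirling2_gt ?mul0n ?addn0 -?big_split /=; last by rewrite /m; lia.
by apply: eq_bigr => d _; rewrite mulnDr.
Qed.


(** Invariant after [i] rows: [Z] is the set of staircase cells used and [d] rows are deferred. As
    the [X j] are nested, [Z] lies in [X i], which has [i + delta - #|Z| = d + delta] free cells. *)
Lemma placements_stairs delta (X : nat -> {set J}) D rest Y0 val q :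
  (forall i j, i <= j -> X i \subset X j) ->
  (forall i, i < q -> [/\ #|X i| = i + delta, X i \subset Y0 & [disjoint X i & D]]) ->
  (forall (Z : {set J}) d, Z \subset Y0 -> [disjoint Z & D] -> #|Z| + d = q ->
     placements (nseq d D ++ rest) (Y0 :\: Z) = val d) ->
  forall i d (Z : {set J}), i <= q -> Z \subset Y0 -> [disjoint Z & D] ->
    (i < q -> Z \subset X i) -> #|Z| + d = i ->
  placements ([seq X j :|: D | j <- iota i (q - i)] ++ nseq d D ++ rest) (Y0 :\: Z) =
  stair_weight delta val (q - i) d.
Proof.
move=> mono hX hval i d Z iq.
have [m em] : exists m, m = q - i by exists (q - i).
rewrite -em; elim: m i d Z iq em => [|m IH] i d Z iq em ZY ZD Zx card.
  by apply: hval => //; lia.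
have iq' : i < q by lia.
have [cX XY XD] := hX i iq'; have ZX := Zx iq'.
rewrite [iota _ _]/= map_cons cat_cons placements_split // [RHS]/=; congr (_ + _); last first.
  (* Row [i] is deferred: its remainder [D] moves behind the other staircase rows. *)
  rewrite (@placements_perm _ ([seq X j :|: D | j <- iota i.+1 m] ++ nseq d.+1 D ++ rest)); last first.
    by rewrite -cat1s perm_catCA.
  apply: IH => //; try lia.
  by move=> _; apply: subset_trans ZX (mono _ _ _).
transitivity (\sum_(c in X i :\: Z) stair_weight delta val m d).
  apply: eq_big => [c|c /andP[]].
    by rewrite !inE; have [/(subsetP XY) ->|] := boolP (c \in X i); rewrite ?andbT ?andbF.
  rewrite !inE => /andP[cZ cY] cXi.
  rewrite setDDl setUC; apply: IH => //; try lia.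
  - by rewrite subUset sub1set cY.
  - by rewrite -setI_eq0 setIUl setU_eq0 !setI_eq0 disjoints1 (disjointFr XD cXi).
  - move=> lt; rewrite subUset sub1set (subsetP (mono _ _ (leqnSn i))) //.
    exact: subset_trans ZX (mono _ _ _).
  - by rewrite cardsU1 cZ; lia.
rewrite sum_nat_const cardsD (setIidPr ZX) cX; congr (_ * _); lia.
Qed.

End Rook.

(** * From placements to permutations in the band *)

(** Generalised for induction: values outside [r] are prescribed by [f], and [Y] holds the values
    still free. *)
Lemma card_perm_placements n (B : 'I_n -> {set 'I_n}) :
  #|[set s : 'S_n | [forall i, s i \in B i]]| = placements [seq B i | i <- enum 'I_n] setT.
Proof.
suff H (r : seq 'I_n) (f : 'I_n -> 'I_n) (Y : {set 'I_n}) : uniq r ->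
    {in [predC r] &, injective f} -> (forall i, i \notin r -> f i \notin Y) ->
    #|Y| = size r ->
    #|[set s : 'S_n | [forall i, if i \in r then s i \in B i else s i == f i]]| =
    placements (map B r) Y.
  rewrite -(H (enum 'I_n) id) ?enum_uniq //; last by rewrite cardsT size_enum_ord card_ord.
    apply: eq_card => s; rewrite !inE; apply: eq_forallb => i.
    by rewrite mem_enum.
  by move=> i; rewrite mem_enum.
elim: r f Y => [|i r IH] f Y /=.
  move=> _ finj _ _; have fi : injective f by move=> a b; apply: finj.
  apply/eqP/cards1P; exists (perm fi); apply/setP => s; rewrite !inE.
  apply/forallP/eqP => [e|-> j]; last by rewrite permE.
  by apply/permP => j; rewrite permE; apply/eqP.
case/andP=> ir ur finj fY cY; rewrite -sum1_card.
(* By cardinality the prescribed values exhaust the complement of [Y], which forces [s i] into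
   [Y]. *)
have fim : f @: [set j | j \notin i :: r] = ~: Y.
  apply/eqP; rewrite eqEcard; apply/andP; split.
    by apply/subsetP => x /imsetP[j]; rewrite !inE => jr ->; apply: fY; rewrite inE.
  rewrite card_in_imset => [|a b]; last by rewrite !inE; apply: finj; rewrite !inE.
  have c1 := cardsC Y; have := cardsC [set j | j \in i :: r].
  have -> : ~: [set j | j \in i :: r] = [set j | j \notin i :: r].
    by apply/setP => j; rewrite !inE.
  have -> : #|[set j | j \in i :: r]| = size (i :: r).
    by rewrite cardsE; apply/card_uniqP; rewrite /= ir.
  by move=> c2; rewrite -(leq_add2l #|Y|) c1 -c2 leq_add2r cY.
rewrite (partition_big (fun s : 'S_n => s i) (fun c => (c \in Y) && (c \in B i))) /=; last first.
  move=> s; rewrite inE => /forallP sB.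
  have := sB i; rewrite mem_head => ->; rewrite andbT; apply/negPn/negP => nY.
  have : s i \in ~: Y by rewrite inE.
  rewrite -fim => /imsetP[j]; rewrite inE => jr.
  have := sB j; rewrite (negPf jr) => /eqP <- /perm_inj ij.
  by rewrite -ij mem_head in jr.
apply: eq_bigr => c /andP[cY' cB].
rewrite -(IH (fun j => if j == i then c else f j) (Y :\ c)) //.
- rewrite -sum1_card; apply: eq_bigl => s; rewrite !inE.
  apply/andP/forallP => [[/forallP sB /eqP si] j|sB].
    have := sB j; rewrite inE; have [->|_] := eqVneq j i; last by [].
    by rewrite (negPf ir) si eqxx.
  have si : s i = c by have := sB i; rewrite (negPf ir) eqxx => /eqP.
  split; last exact/eqP.
  apply/forallP => j; have := sB j; rewrite inE.
  by have [->|_] := eqVneq j i; rewrite ?(negPf ir) ?si.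
- move=> a b; rewrite !inE => ar br.
  have [->|ai] := eqVneq a i; have [->|bi] := eqVneq b i => //.
  + by move=> e; have := fY b; rewrite -e cY' inE (negPf bi) (negPf br) => /(_ isT).
  + by move=> e; have := fY a; rewrite e cY' inE (negPf ai) (negPf ar) => /(_ isT).
  + by apply: finj; rewrite !inE ?(negPf ai) ?(negPf bi).
- move=> j jr; have [_|ji] := eqVneq j i; first by rewrite !inE eqxx.
  by rewrite inE negb_and fY ?orbT // inE (negPf ji).
- by have := cY; rewrite (cardsD1 c) cY' add1n => -[].
Qed.

Definition seg n a b : {set 'I_n} := [set c : 'I_n | a <= c < b].

Lemma card_seg n a b : b <= n -> #|seg n a b| = b - a.
Proof.
move=> bn; rewrite /seg -sum1dep_card -(big_mkord (fun i => a <= i < b) (fun=> 1)).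
rewrite -[RHS]muln1 -sum_nat_const_nat (big_nat_widenl a 0) //.
by rewrite (big_nat_widen 0 b n) //; apply: eq_bigl => i; rewrite andTb.
Qed.

(** Row [i < p] is [L] plus a stair of [i + 1] cells in [R]; row [p + i] is [R] plus a stair of
    [k - i - 1] cells in [L]. Hence [delta] is 1 for the top and 0 for the bottom. *)
Lemma card_band_perm n p k : n = p + k ->
  #|[set s : 'S_n | [forall i : 'I_n, (s i <= i + k) && (i < s i + p)]]| = polyBernC p k.
Proof.
move=> en; pose B (i : nat) : {set 'I_n} := [set c : 'I_n | (c <= i + k) && (i < c + p)].
have -> : [set s : 'S_n | [forall i : 'I_n, (s i <= i + k) && (i < s i + p)]] =
    [set s : 'S_n | [forall i, s i \in B i]].
  by apply/setP => s; rewrite !inE; apply: eq_forallb => i; rewrite inE.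
rewrite card_perm_placements; set L := seg n 0 k; set R := seg n k n.
pose X1 j := seg n k (k + j.+1); pose X2 j := seg n (k - j) k.
pose tops := [seq X1 j :|: L | j <- iota 0 p]; pose bots := [seq X2 j :|: R | j <- iota 0 k].
have dLR : [disjoint L & R].
  by rewrite -setI_eq0; apply/eqP/setP => c; rewrite !inE; lia.
have val2 (Z : {set 'I_n}) d : [disjoint Z & L] -> #|Z| + d = p ->
    placements (nseq d L ++ bots) (setT :\: Z) = stirling2 k d * d`! ^ 2.
  move=> ZL Zd; rewrite (@placements_perm _ _ (bots ++ nseq 0 R ++ nseq d L)); last first.
    by rewrite perm_catC.
  rewrite -[setT :\: Z]setD0 (_ : bots = [seq X2 j :|: R | j <- iota 0 (k - 0)]); last by rewrite subn0.
  rewrite (@placements_stairs _ 0 X2 R (nseq d L) _ (fun e => d ^_ e * e ^_ d) k) ?sub0set //.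
  - rewrite subn0 stair_weightE //.
    (* With [e] bottom rows deferred, [d] cells of [R] and [e] cells of [L] are free for [e] and [d]
       rows respectively, so only [e = d] contributes. *)
    rewrite (eq_bigr (fun e : 'I_k.+1 => if e == d :> nat then stirling2 k d * d`! ^ 2 else 0)).
      rewrite -big_mkcond /=; have [dk|kd] := leqP d k.
        by rewrite (big_pred1 (Ordinal (dk : d < k.+1))).
      by rewrite stirling2_gt // big_pred0 // => e; apply/negbTE; have := ltn_ord e; lia.
    move=> e _; rewrite !addn0; have [de|de|->] := ltngtP e d.
    + by rewrite (@ffact_small e d) // !muln0.
    + by rewrite (@ffact_small d e) // mul0n muln0.
    + by rewrite !ffactnn -mulnn.
  - by move=> i j ij; apply/subsetP => c; rewrite !inE; lia.
  - move=> i ik; split; first by rewrite card_seg; lia.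
    + apply/subsetP => c cX; rewrite !inE andbT; apply/negP => cZ.
      by have := disjointFr ZL cZ; move: cX; rewrite !inE; lia.
    + by rewrite -setI_eq0; apply/eqP/setP => c; rewrite !inE; lia.
  - move=> Z' e Z'Y Z'R Z'e; rewrite placements_two_types; last by rewrite disjoint_sym.
    congr (_ ^_ _ * _ ^_ _).
      have -> : (setT :\: Z :\: Z') :&: R = R :\: Z.
        apply/setP => c; rewrite in_setI !in_setD in_setT andbT.
        have [cR|] := boolP (c \in R); rewrite ?andbF // !andbT.
        by rewrite (disjointFl Z'R cR).
      rewrite cardsD (setIidPr _) ?card_seg; try lia.
      apply/subsetP => c cZ; have := disjointFr ZL cZ; rewrite !inE; have := ltn_ord c; lia.
    have -> : (setT :\: Z :\: Z') :&: L = L :\: Z'.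
      apply/setP => c; rewrite in_setI !in_setD in_setT andbT.
      have [cL|] := boolP (c \in L); rewrite ?andbF // !andbT.
      by rewrite (disjointFl ZL cL) andbT.
    rewrite cardsD (setIidPr _) ?card_seg; try lia.
    apply/subsetP => c cZ; have := disjointFr Z'R cZ; rewrite !inE; have := ltn_ord c; lia.
  - by rewrite -setI_eq0 set0I.
  - by rewrite cards0.
have rows : perm_eq [seq B (val i) | i <- enum 'I_n] (tops ++ nseq 0 L ++ bots).
  rewrite map_comp val_enum_ord (_ : iota 0 n = iota 0 p ++ iota p k); last by rewrite en iotaD.
  rewrite map_cat cat0s.
  rewrite (_ : [seq B i | i <- iota 0 p] = tops); last first.
    apply/eq_in_map => i; rewrite mem_iota => ip; apply/setP => c; rewrite !inE.
    by have := ltn_ord c; lia.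
  rewrite perm_cat2l -[p in iota p k]addn0 iotaDl -map_comp.
  (* The bottom stairs shrink downwards; reversing the rows makes them grow. *)
  rewrite (_ : map _ _ = [seq X2 j :|: R | j <- [seq k - i.+1 | i <- iota 0 k]]); last first.
    rewrite -map_comp; apply/eq_in_map => i; rewrite mem_iota => ip; apply/setP => c.
    by rewrite !inE; have := ltn_ord c; lia.
  apply: perm_map; apply: uniq_perm; rewrite ?iota_uniq //.
    rewrite map_inj_in_uniq ?iota_uniq // => i j; rewrite !mem_iota; lia.
  move=> j; rewrite mem_iota add0n; apply/mapP/idP => [[i]|jk].
    by rewrite mem_iota => ik ->; lia.
  by exists (k - j.+1); rewrite ?mem_iota; lia.
rewrite (placements_perm _ rows) -[setT]setD0.
rewrite (_ : tops = [seq X1 j :|: L | j <- iota 0 (p - 0)]); last by rewrite subn0.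
rewrite (@placements_stairs _ 1 X1 L bots _ (fun d => stirling2 k d * d`! ^ 2) p) ?sub0set //.
- rewrite subn0 stair_weightE // /polyBernC.
  (* The sum is extended from [minn p k] to [p]; the added terms have [d > k] and vanish. *)
  rewrite (big_ord_widen p.+1 (fun m => m`! ^ 2 * stirling2 p.+1 m.+1 * stirling2 k m)); last by lia.
  rewrite [RHS]big_mkcond; apply: eq_bigr => d _; rewrite !addn1.
  case: ltnP => dk; first by rewrite mulnA mulnC mulnA.
  by rewrite (@stirling2_gt k) ?muln0 //; have := ltn_ord d; lia.
- by move=> i j ij; apply/subsetP => c; rewrite !inE; lia.
- move=> i ip; split; first by rewrite card_seg; lia.
  + exact: subsetT.
  + by rewrite -setI_eq0; apply/eqP/setP => c; rewrite !inE; lia.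
- by move=> Z d _ ZL; apply: val2.
- by rewrite -setI_eq0 set0I.
- by rewrite cards0.
Qed.

Theorem theorem2p8 (n p : nat) :
  1 <= n -> 1 <= p <= n ->
  (forall pi : 'S_n,
     (forall r, 1 <= r <= n.+1 -> inT r p pi) <->
     (forall i : 'I_n, p + i.+1 <= pinvpos pi i + n /\ pinvpos pi i <= p + i.+1 - 1))
  /\
  (forall A : {set 'S_n},
     (forall pi : 'S_n, pi \in A <-> (forall r, 1 <= r <= n.+1 -> inT r p pi)) ->
     #|A| = polyBernC p (n - p)).
Proof.
move=> _ pn; split=> [pi|A defA]; first exact: all_inT.
rewrite -(@card_band_perm n); last by lia.
(* The band is stated by labels but counted by sites; [pi] and its inverse translate between the
   two. *)
apply: eq_card => pi; rewrite inE; apply/idP/forallP => [/defA/(all_inT _ pn) all i|band].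
  by have := all (pi i); rewrite /pinvpos permK; lia.
apply/defA/(all_inT _ pn) => i; have := band ((perm_inv pi) i).
by rewrite /pinvpos permKV; lia.
Qed.
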